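(* If $(X,d)$ is a locally compact metric space and the space $\Sigma(X)$ of connected components of $X$ is compact, then the group of isometries $I(X,d)$ is closed in $C(X,X)$.
   Context: An isometry of $(X,d)$ is a surjective distance-preserving map $X\to X$; $I(X,d)$ is the group of all isometries. $C(X,X)$ is the space of continuous maps $X\to X$ endowed with the topology of pointwise convergence. $\Sigma(X)$ is the set of connected components of $X$ with the quotient topology via the natural map $q:X\to\Sigma(X)$ sending each point to its connected component; it need not be Hausdorff, and ''compact'' for $\Sigma(X)$ means that every open cover has a finite subcover. *)

(* Defs.v *)
From HB Require Import structures.
From mathcomp Require Import all_boot all_order all_algebra.
From mathcomp Require Import all_classical all_reals all_analysis.

Set Implicit Arguments.
Unset Strict Implicit.
Unset Printing Implicit Defensive.

Import Order.TTheory GRing.Theory Num.Theory.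

Local Open Scope classical_set_scope.
Local Open Scope ring_scope.

Section component_space.
Variable X : topologicalType.

Definition components : Type :=
  set_type (range (connected_component [set: X])).

HB.instance Definition _ := Choice.on components.

Definition to_component (x : X) : components :=
  SigSub (mem_set (imageT (connected_component [set: X]) x)).

Definition component_repr (C : components) : X := sval (cid2 (set_valP C)).

Lemma component_reprK : cancel component_repr to_component.
Proof. by move=> C; apply: val_inj; rewrite /component_repr /=; case: cid2. Qed.

HB.instance Definition _ := isQuotient.Build X components component_reprK.

(* The space usually written [Sigma(X)]. *)
Definition component_space : Type := quotient_topology components.

HB.instance Definition _ := Topological.on component_space.

Lemma component_spaceE (x y : X) :
  to_component x = to_component y <-> connected_component [set: X] x y.
Proof.
split=> [/(congr1 val)/= xy|xy]; last exact/val_inj/same_connected_component.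
by rewrite xy; exact: connected_component_refl.
Qed.

Lemma open_component_spaceE (U : set component_space) :
  open U = open (to_component @^-1` U).
Proof.
rewrite [LHS]/open/= /quotient_open; congr open.
by apply/seteqP; split => x /=; rewrite unlock.
Qed.

End component_space.

(* [C(X, Y)] with the topology induced by the product topology on [X -> Y].
   The library's own instance for [continuousType] is only available locally,
   through [ArrowAsProduct]. *)
Definition ptws_continuous (X Y : topologicalType) : Type :=
  initial_topology (fun f : continuousType X Y => (f : {ptws X -> Y})).

HB.instance Definition _ (X Y : topologicalType) :=
  Topological.on (ptws_continuous X Y).

Section isometries.
Variables (R : realType) (X : metricType R).

Definition is_isometry (f : X -> X) : Prop :=
  range f = [set: X] /\ forall x y, mdist (f x) (f y) = mdist x y.

Lemma isometry_continuous f : is_isometry f -> continuous f.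
Proof.
move=> [_ df] x; apply/cvg_ballP => e e0; near=> y.
have : ball x e y by near: y; exact: nbhsx_ballx.
by rewrite !ballEmdist /= df.
Unshelve. all: by end_near. Qed.

Lemma isometry_id : is_isometry id.
Proof. by split; first exact: image_id. Qed.

Lemma isometry_comp f g : is_isometry f -> is_isometry g -> is_isometry (f \o g).
Proof.
move=> [fT df] [gT dg]; split => [|x y /=]; last by rewrite df dg.
by rewrite -(image_comp g f) gT.
Qed.

Lemma isometry_inv f : is_isometry f ->
  exists2 g, is_isometry g & cancel f g /\ cancel g f.
Proof.
move=> [fT df].
have fs y : exists x, f x = y.
  by have : range f y by [rewrite fT]; move=> [x _ <-]; exists x.
pose g y := sval (cid (fs y)).
have gK : cancel g f by move=> y; rewrite /g; case: cid.
have fK : cancel f g.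
  by move=> x; apply: (@mdist_positivity R X); rewrite -df gK mdistxx.
exists g => //; split => [|x y]; last by rewrite -df !gK.
by apply/seteqP; split => // x _; exists (f x).
Qed.

(* [isometry_continuous] ensures that the set below contains every isometry,
   and the other lemmas above that it is a group under composition. *)
Definition isometry_group : set (ptws_continuous X X) :=
  [set f : continuousType X X | is_isometry f].

End isometries.

Arguments isometry_group {R} X.

(* Main.v *)
(* Call two points related if, for some [r], they are at distance less than [r]
   and the balls of radius [r] around both lie in compact sets.  Isometries
   preserve this relation, and by local compactness the classes of the
   equivalence it generates are clopen, hence unions of components; compactness
   of the space of components leaves finitely many classes.
   Let [g] be a pointwise limit of isometries.  A compactness argument shows
   that the range of [g] is a union of classes.  Choose representatives [x] of
   all the classes and an isometry [h] so close to [g] that [h x] and [g x] are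
   equivalent for each of them.  Given [z], the point [h^-1 z] is equivalent to
   some representative [x], so [z] is equivalent to [h x], hence to [g x], and
   [z] lies in the range of [g]. *)
Require Import Defs.
From mathcomp Require Import all_boot all_order all_algebra.
From mathcomp Require Import all_classical all_reals all_analysis.
From mathcomp Require Import finmap lra.
From Stdlib Require Import Relation_Operators.

Set Implicit Arguments.
Unset Strict Implicit.
Unset Printing Implicit Defensive.

Import Order.TTheory GRing.Theory Num.Theory.

Local Open Scope ring_scope.
Local Open Scope classical_set_scope.

Section proper_steps.
Context {R : realType} {X : metricType R}.
Implicit Types (x y z : X) (r s : R) (h : X -> X).

Lemma nbhs_mdist x r : 0 < r -> \forall y \near x, mdist x y < r.
Proof.
by move=> r0; have := nbhsx_ballx x _ r0; rewrite ballEmdist.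
Qed.

(** Asking for a compact superset rather than a compact closure lets the property pass to smaller
    balls and isometric images without computing closures. *)
Definition proper_ball x r := exists2 K : set X, compact K & ball x r `<=` K.

Lemma proper_ball_shift x y r s :
  mdist x y + s <= r -> proper_ball x r -> proper_ball y s.
Proof.
move=> xys [K cK xrK]; exists K => // z; rewrite ballEmdist /= => yz.
apply: xrK; rewrite ballEmdist /=; have := metric_triangle x y z; lra.
Qed.

Lemma proper_ball_isometry h x r :
  is_isometry h -> proper_ball x r -> proper_ball (h x) r.
Proof.
move=> ih [K cK xrK]; have [ht dh] := ih; exists (h @` K).
  apply: continuous_compact => //.
  exact/continuous_subspaceT/isometry_continuous.
move=> z; have : range h z by rewrite ht.
move=> [w _ <-]; rewrite ballEmdist /= dh => xw.
by exists w => //; apply: xrK; rewrite ballEmdist.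
Qed.

Definition proper_step x y :=
  exists r, [/\ mdist x y < r, proper_ball x r & proper_ball y r].

Lemma proper_step_sym x y : proper_step x y -> proper_step y x.
Proof. by move=> [r [xyr xr yr]]; exists r; rewrite metric_sym. Qed.

Lemma proper_step_isometry h x y :
  is_isometry h -> proper_step x y -> proper_step (h x) (h y).
Proof.
move=> ih [r [xyr xr yr]]; exists r; split; rewrite ?ih.2//;
  exact: proper_ball_isometry.
Qed.

Definition proper_equiv := clos_refl_sym_trans X proper_step.

Lemma proper_equiv_isometry h x y :
  is_isometry h -> proper_equiv x y -> proper_equiv (h x) (h y).
Proof.
move=> ih; elim=> {x y} [x y xy|x|x y _|x y z _ xy _ yz].
- exact/rst_step/proper_step_isometry.
- exact: rst_refl.
- exact: rst_sym.
- exact: rst_trans yz.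
Qed.

Hypothesis lcX : locally_compact [set: X].

Lemma proper_ball_exists x : exists2 r, 0 < r & proper_ball x r.
Proof.
have [U + [cU _]] := lcX (I : [set: X] x).
rewrite withinET => /nbhs_ballP[r r0 xrU].
by exists r => //; exists U.
Qed.

Lemma nbhs_proper_equiv x : \forall y \near x, proper_equiv x y.
Proof.
have [r r0 xr] := proper_ball_exists x.
have r20 : 0 < r / 2 by lra.
apply: filterS (nbhs_mdist x r20) => y xy; apply: rst_step.
exists (r / 2); split => //; apply: proper_ball_shift xr; last lra.
by rewrite mdistxx; lra.
Qed.

Lemma open_proper_class x : open [set y | proper_equiv x y].
Proof.
rewrite openE => y xy; apply: filterS (nbhs_proper_equiv y) => z.
exact: rst_trans.
Qed.

Lemma closed_proper_class x : closed [set y | proper_equiv x y].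
Proof.
move=> y /(_ _ (nbhs_proper_equiv y))[z [xz yz]].
exact: rst_trans xz (rst_sym _ _ _ _ yz).
Qed.

(** The class of [x] is clopen, so it cuts a connected set containing [x] in a nonempty relatively
    clopen subset, hence in all of it. *)
Lemma connected_component_proper_equiv x y :
  connected_component [set: X] x y -> proper_equiv x y.
Proof.
move=> [C [Cx _ cC] Cy].
suff CE : C `&` [set z | proper_equiv x z] = C.
  by move: Cy; rewrite -CE => -[].
apply: cC; first by exists x; split => //; exact: rst_refl.
  by exists [set z | proper_equiv x z] => //; exact: open_proper_class.
by exists [set z | proper_equiv x z] => //; exact: closed_proper_class.
Qed.

Lemma finite_proper_classes : cover_compact [set: component_space X] ->
  exists D : {fset X}, forall y, exists2 x, x \in D & proper_equiv x y.
Proof.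
move=> cX.
(* Classes are saturated for [to_component], being unions of components; this makes their images
   open in the quotient. *)
have pre x :
    @to_component X @^-1` (@to_component X @` [set y | proper_equiv x y]) =
    [set y | proper_equiv x y].
  apply/seteqP; split => y /=; last by exists y.
  move=> [z xz /component_spaceE/connected_component_proper_equiv].
  exact: rst_trans.
have [||D _ DX] := cX X [set: X]
    (fun x => @to_component X @` [set y | proper_equiv x y]).
- by move=> x _; rewrite open_component_spaceE pre; exact: open_proper_class.
- move=> C _; exists (component_repr C) => //; exists (component_repr C).
    exact: rst_refl.
  exact: component_reprK.
exists D => y; have [x xD] := DX (to_component y) I; exists x => //.
by have : (@to_component X @^-1`
  (@to_component X @` [set y | proper_equiv x y])) y by []; rewrite pre.
Qed.

Section pointwise_limit.
Variables (F : set_system (X -> X)) (g : X -> X).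
Context {FF : ProperFilter F}.
Hypothesis isoF : \forall h \near F, is_isometry h.
Hypothesis Fg : forall x, (fun h => h x) @ F --> g x.

Lemma near_limit x e : 0 < e -> \forall h \near F, mdist (g x) (h x) < e.
Proof. by move=> e0; exact: (Fg (nbhs_mdist (g x) e0)). Qed.

Lemma limit_mdist x y : mdist (g x) (g y) = mdist x y.
Proof.
apply/eqP; rewrite -subr_eq0 -normr_le0; apply/ler_addgt0Pl => e e0.
have e20 : 0 < e / 2 by lra.
near F => h.
have [_ dh] : is_isometry h by near: h.
have gx : mdist (g x) (h x) < e / 2 by near: h; exact: near_limit.
have gy : mdist (g y) (h y) < e / 2 by near: h; exact: near_limit.
rewrite addr0 -(dh x y) ler_norml.
have := metric_triangle (g x) (h x) (g y).
have := metric_triangle (h x) (h y) (g y).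
have := metric_triangle (h x) (g x) (h y).
have := metric_triangle (g x) (g y) (h y).
rewrite (metric_sym (h x) (g x)) (metric_sym (h y) (g y)); lra.
Unshelve. all: by end_near. Qed.

(* If [z] is not in the range of [g], then no isometry [h] close to [g] maps a
   point of the compact set [K] to [z] (near-covering);
   but [h^-1 z] is in [K]. *)
Lemma limit_range_ball x z r :
  proper_ball x r -> mdist (g x) z < r -> range g z.
Proof.
move=> [K cK xrK] gxz; apply: contrapT => ngz.
(* If [h x] is within this slack of [g x], then [h^-1 z] is at distance [mdist (h x) z < r] from
   [x], hence in [K]. *)
have e0 : 0 < r - mdist (g x) z by lra.
have avoid : \forall h \near F, K `<=` [set w | h w <> z].
  apply: (compact_near_coveringP K).1 => // w _.
  (* One half pays for moving from [g w] to [h w], the other for moving from [h w] to [h w'], so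
     [h w'] cannot reach [z]. *)
  have d0 : 0 < mdist (g w) z / 2.
    by rewrite divr_gt0// mdist_gt0; apply/eqP => gwz; apply: ngz; exists w.
  near=> w' h => /= hw'z.
  have [_ dh] : is_isometry h by near: h.
  have ww' : mdist w w' < mdist (g w) z / 2 by near: w'; exact: nbhs_mdist.
  have gh : mdist (g w) (h w) < mdist (g w) z / 2 by near: h; exact: near_limit.
  have := metric_triangle (g w) (h w) (h w'); rewrite dh hw'z; lra.
near F => h.
have [ht dh] : is_isometry h by near: h.
have : range h z by rewrite ht.
move=> [w _ hwz].
have Kz : K `<=` [set w | h w <> z] by near: h.
apply: (Kz w) => //; apply: xrK; rewrite ballEmdist /= -dh hwz.
have : mdist (g x) (h x) < r - mdist (g x) z by near: h; exact: near_limit.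
have := metric_triangle (h x) (g x) z; rewrite (metric_sym (h x) (g x)); lra.
Unshelve. all: by end_near. Qed.

(** [limit_range_ball] needs a proper ball around [x], but one is given around [y = g x]. Giving up
    [e] of the radius moves it to [h x] for an isometry [h] near [g], and [h^-1] carries it to [x];
    [r - e] still exceeds [mdist y z]. *)
Lemma limit_range_step y z : proper_step y z -> range g y -> range g z.
Proof.
move=> [r [yzr yr _]] [x _ gx].
pose e := (r - mdist y z) / 2; have e0 : 0 < e by rewrite /e; lra.
near F => h.
have ih : is_isometry h by near: h.
have [k ik [hK _]] := isometry_inv ih.
have gh : mdist (g x) (h x) < e by near: h; exact: near_limit.
apply: (@limit_range_ball x z (r - e)); last by rewrite gx /e; lra.
rewrite -(hK x); apply: proper_ball_isometry => //.
by apply: proper_ball_shift yr; rewrite -gx; lra.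
Unshelve. all: by end_near. Qed.

Lemma limit_range_equiv y z : proper_equiv y z -> range g y <-> range g z.
Proof.
elim=> {y z} [y z yz|y|y z _|x y z _ xy _ yz].
- by split; apply: limit_range_step => //; exact: proper_step_sym.
- by [].
- exact: iff_sym.
- exact: iff_trans yz.
Qed.

Lemma limit_isometry :
  cover_compact [set: component_space X] -> is_isometry g.
Proof.
move=> /finite_proper_classes[D DX]; split; last exact: limit_mdist.
apply/seteqP; split => // z _.
(* Finiteness of [D] is what lets a single [h] serve all representatives. *)
have FD : \forall h \near F, forall x, x \in D -> proper_equiv (g x) (h x).
  apply: (@filter_bigI _ _ D
    (fun x => [set h | proper_equiv (g x) (h x)])) => x _.
  exact: (Fg (nbhs_proper_equiv (g x))).
near F => h.
have ih : is_isometry h by near: h.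
have [k ik [_ kK]] := isometry_inv ih.
have [x xD xkz] := DX (k z).
have hxz : proper_equiv (h x) z.
  by rewrite -(kK z); exact: proper_equiv_isometry.
have gxz : proper_equiv (g x) z by apply: rst_trans hxz; apply: (near FD h).
by apply/(limit_range_equiv gxz); exists x.
Unshelve. all: by end_near. Qed.

End pointwise_limit.
End proper_steps.

Lemma ptws_continuous_eval (X Y : topologicalType) (x : X) :
  continuous (fun f : ptws_continuous X Y => f x).
Proof.
move=> f; apply: (@continuous_comp (ptws_continuous X Y) {ptws X -> Y} Y
  (fun f : continuousType X Y => (f : {ptws X -> Y})) (fun f => f x)).
  exact: initial_continuous.
exact: (@proj_continuous X (fun=> Y) x).
Qed.

Theorem proposition3p6 (R : realType) (X : metricType R) :
  locally_compact [set: X] ->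
  cover_compact [set: component_space X] ->
  closed (isometry_group X).
Proof.
move=> lcX cX g clg.
(* The trace of the neighbourhoods of [g] on the isometry group is a proper filter because [g] lies
   in the closure. *)
pose F := (fun f : ptws_continuous X X => (f : X -> X)) @
  within (isometry_group X) (nbhs g).
have PF : ProperFilter (within (isometry_group X) (nbhs g)).
  exact: within_nbhs_proper.
apply: (@limit_isometry R X lcX F g) => //.
  by apply: (@withinT _ _ (isometry_group X)); exact: nbhs_filter.
move=> x A /(@ptws_continuous_eval X X x g) gA.
have {}gA : nbhs g [set f : ptws_continuous X X | A (f x)] by exact: gA.
suff : nbhs g [set f : ptws_continuous X X | isometry_group X f -> A (f x)].
  by [].
by apply: filterS gA => f Af _.
Qed.
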